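(* Let $N\ge 1$ and let $M:=\oplus_{i=1}^{N}M_i$, where every $(M_i,d_i)$ is either a doubling metric space or a Gromov hyperbolic metric space of bounded geometry. Then $M$ is universal with respect to simultaneous Lipschitz extensions.
   Context: Direct sum: $\oplus_{i=1}^{N}M_i$ is the metric space with underlying set $\prod_{i=1}^{N}M_i$ and metric $d:=\max_{1\le i\le N}d_i$. Doubling: a metric space is doubling if there is a constant $D$ such that for each $R>0$ every ball of radius $2R$ can be covered by at most $D$ balls of radius $R$. Lipschitz spaces: for a metric space $(M,d)$ and a Banach space $X$, $Lip(M,X)$ is the space of Lipschitz functions $f:M\to X$ with the seminorm $L(f):=\sup_{m\ne m'}\|f(m)-f(m')\|/d(m,m')$. A subset $S\subset M$ is regarded as a metric space with the induced metric. Extension constant: a simultaneous Lipschitz extension from $S$ to $M$ is a continuous linear operator $T:Lip(S,X)\to Lip(M,X)$ with $Tf|_S=f$ for all $f$. The set of all such $T$ is $Ext(S,M;X)$ and $\lambda(S,M;X):=\inf\{\|T\| : T\in Ext(S,M;X)\}$ ($=\infty$ if $Ext(S,M;X)=\emptyset$), where $\|T\|$ is the operator norm with respect to the seminorms $L$. Universality: a metric space $U$ is universal (with respect to simultaneous Lipschitz extensions) if there is a constant $c(U)$ depending only on $U$ such that for an arbitrary metric space $M$, every subspace $S$ of $M$ isometric to a subspace of $U$, and every Banach space $X$, one has $\lambda(S,M;X)\le c(U)$. $C$-isometric embedding ($C\ge1$): an injection $\phi:(M,d)\to(M_1,d_1)$ with $C^{-1}d(m,m')\le d_1(\phi(m),\phi(m'))\le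 C\,d(m,m')$ for all $m,m'\in M$. Bounded geometry: a metric space is of bounded geometry with parameters $n,R,C$ if every open ball of radius $R$ in it admits a $C$-isometric embedding into Euclidean $\mathbb{R}^n$; it is of bounded geometry if this holds for some integer $n$, some $R>0$ and some $C\ge 1$. Gromov hyperbolic: a geodesic metric space (every two points are joined by a geodesic segment, i.e. the image of a curve $\gamma:[0,a]\to M$ with $d(\gamma(t),\gamma(s))=|t-s|$) is $\delta$-hyperbolic ($\delta\ge0$) if in every geodesic triangle each side lies in the $\delta$-neighbourhood of the union of the other two sides. It is (Gromov) hyperbolic if it is $\delta$-hyperbolic for some $\delta\ge0$. *)

(* Defs.v *)
From HB Require Import structures.
From mathcomp Require Import all_boot all_order all_algebra.
From mathcomp Require Import all_classical all_reals all_analysis.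
From mathcomp Require Import ring lra.

Set Implicit Arguments.
Unset Strict Implicit.
Unset Printing Implicit Defensive.

Import Order.TTheory GRing.Theory Num.Theory.
Import numFieldNormedType.Exports.

Local Open Scope classical_set_scope.
Local Open Scope ring_scope.

(* A subset S of a metric space, coerced to the type of its points, carries
   the induced metric (and is then a metricType). *)
Section induced_metric.
Context {R : realType} {M : metricType R} (S : set M).

Let dist (x y : S) : R := mdist (set_val x) (set_val y).

Let dist_ge0 x y : 0 <= dist x y. Proof. exact: mdist_ge0. Qed.

Let dist_positivity x y : dist x y = 0 -> x = y.
Proof. by move=> /mdist_positivity /val_inj. Qed.

Let ballEdist (x : S) (d : R) : ball x d = [set y | dist x y < d].
Proof.
apply/seteqP; split => y; rewrite /dist /=.
- by rewrite -[X in X -> _]/(ball (set_val x) d (set_val y)) ballEmdist.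
- by move=> h; rewrite -[ball x d y]/(ball (set_val x) d (set_val y)) ballEmdist.
Qed.

HB.instance Definition _ := @PseudoMetric_isMetric.Build R (set_type S)
  dist dist_ge0 dist_positivity ballEdist.

End induced_metric.

(* The product type with the maximum of the coordinate distances. *)
Definition direct_sum (R : realType) (N : nat) (M : 'I_N -> metricType R) :
  Type := forall i, M i.

Section direct_sum_metric.
Context {R : realType} {N : nat} (M : 'I_N -> metricType R).

Let dist (x y : direct_sum M) : R :=
  \big[Num.max/0]_(i < N) mdist (x i) (y i).

Let dist_le x y (r : R) : 0 <= r -> (forall i, mdist (x i) (y i) <= r) ->
  dist x y <= r.
Proof. by move=> r0 h; apply: bigmax_le. Qed.

Let le_dist x y i : mdist (x i) (y i) <= dist x y.
Proof. exact: (le_bigmax _ (fun i => mdist (x i) (y i))). Qed.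

Let dist_ge0 x y : 0 <= dist x y.
Proof. exact: bigmax_ge_id. Qed.

Let distxx x : dist x x = 0.
Proof.
apply/eqP; rewrite eq_le dist_ge0 andbT.
by apply: dist_le => // i; rewrite mdistxx.
Qed.

Let dist_positivity x y : dist x y = 0 -> x = y.
Proof.
move=> xy0; apply: functional_extensionality_dep => i.
apply: mdist_positivity; apply/eqP; rewrite eq_le mdist_ge0 andbT.
by rewrite -xy0.
Qed.

Let dist_sym x y : dist x y = dist y x.
Proof. by apply: eq_bigr => i _; rewrite metric_sym. Qed.

Let dist_triangle y x z : dist x z <= dist x y + dist y z.
Proof.
apply: dist_le => [|i]; first by rewrite addr_ge0.
by rewrite (le_trans (metric_triangle _ (y i) _))// lerD.
Qed.

HB.instance Definition _ := gen_eqMixin (direct_sum M).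
HB.instance Definition _ := gen_choiceMixin (direct_sum M).
HB.instance Definition _ := @isMetric.Build R (direct_sum M)
  dist distxx dist_positivity dist_sym dist_triangle.

End direct_sum_metric.

(* 'rV[R]_n carries the sup norm in the library, hence an alias. *)
Definition euclidean (R : realType) (n : nat) : Type := 'rV[R]_n.

Section euclidean_metric.
Context {R : realType} {n : nat}.

Let dist (x y : euclidean R n) : R :=
  Num.sqrt (\sum_(i < n) ((x : 'rV[R]_n) 0 i - (y : 'rV[R]_n) 0 i) ^+ 2).

Let sumsq_ge0 (a : 'I_n -> R) : 0 <= \sum_i a i ^+ 2.
Proof. by apply: sumr_ge0 => i _; exact: sqr_ge0. Qed.

Let sumsq_eq0 (a : 'I_n -> R) : \sum_i a i ^+ 2 = 0 -> forall i, a i = 0.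
Proof.
move=> /eqP; rewrite psumr_eq0 => [/allP h i|i _]; last exact: sqr_ge0.
by have /(_ (mem_index_enum _)) := h i; rewrite sqrf_eq0 => /eqP.
Qed.

Let cauchy_schwarz (a b : 'I_n -> R) :
  (\sum_i a i * b i) ^+ 2 <= (\sum_i a i ^+ 2) * (\sum_i b i ^+ 2).
Proof.
have expand (p q : R) : \sum_i (p * b i - q * a i) ^+ 2 =
    p ^+ 2 * (\sum_i b i ^+ 2) - 2 * p * q * (\sum_i a i * b i)
    + q ^+ 2 * (\sum_i a i ^+ 2).
  rewrite !mulr_sumr -sumrB -big_split /=.
  by apply: eq_bigr => i _; ring.
set c := \sum_i a i * b i; set A := \sum_i a i ^+ 2; set B := \sum_i b i ^+ 2.
have [A0|A0] := eqVneq A 0.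
  rewrite A0 mul0r /c big1 ?expr0n// => i _.
  by rewrite (sumsq_eq0 A0) mul0r.
have Agt0 : 0 < A by rewrite lt_neqAle eq_sym A0 sumsq_ge0.
have : 0 <= \sum_i (A * b i - c * a i) ^+ 2 by exact: sumsq_ge0.
have -> : \sum_i (A * b i - c * a i) ^+ 2 = A * (A * B - c ^+ 2).
  by rewrite expand -/A -/B -/c; move: (A) (B) (c) => A' B' c'; ring.
by rewrite pmulr_rge0// subr_ge0.
Qed.

Let distxx x : dist x x = 0.
Proof. by rewrite /dist big1 ?sqrtr0// => i _; rewrite subrr expr0n. Qed.

Let dist_positivity x y : dist x y = 0 -> x = y.
Proof.
move=> /eqP; rewrite sqrtr_eq0 => h.
have /sumsq_eq0 xy : \sum_(i < n) ((x : 'rV[R]_n) 0 i - (y : 'rV[R]_n) 0 i) ^+ 2 = 0.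
  by apply/eqP; rewrite eq_le h sumsq_ge0.
apply/rowP => i; apply/eqP; rewrite -subr_eq0; apply/eqP; exact: xy.
Qed.

Let dist_sym x y : dist x y = dist y x.
Proof.
by congr Num.sqrt; apply: eq_bigr => i _; rewrite -sqrrN opprB.
Qed.

Let dist_triangle y x z : dist x z <= dist x y + dist y z.
Proof.
pose a i := (x : 'rV[R]_n) 0 i - (y : 'rV[R]_n) 0 i.
pose b i := (y : 'rV[R]_n) 0 i - (z : 'rV[R]_n) 0 i.
have -> : dist x z = Num.sqrt (\sum_i (a i + b i) ^+ 2).
  by congr Num.sqrt; apply: eq_bigr => i _; rewrite /a /b addrA subrK.
rewrite -[dist x y]/(Num.sqrt (\sum_i a i ^+ 2)).
rewrite -[dist y z]/(Num.sqrt (\sum_i b i ^+ 2)).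
have h0 : 0 <= Num.sqrt (\sum_i a i ^+ 2) + Num.sqrt (\sum_i b i ^+ 2).
  by rewrite addr_ge0 ?sqrtr_ge0.
rewrite -(ger0_norm h0) -sqrtr_sqr ler_sqrt ?sqr_ge0//.
rewrite sqrrD !sqr_sqrtr//.
have -> : \sum_i (a i + b i) ^+ 2 =
    \sum_i a i ^+ 2 + (\sum_i a i * b i) *+ 2 + \sum_i b i ^+ 2.
  by rewrite -sumrMnl -!big_split; apply: eq_bigr => i _; rewrite sqrrD.
rewrite lerD2r lerD2l lerMn2r /=.
by rewrite -sqrtrM// (le_trans (ler_norm _))// -sqrtr_sqr ler_wsqrtr.
Qed.

HB.instance Definition _ := Choice.copy (euclidean R n) 'rV[R]_n.
HB.instance Definition _ := @isMetric.Build R (euclidean R n)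
  dist distxx dist_positivity dist_sym dist_triangle.

End euclidean_metric.

Section metric_notions.
Context {R : realType}.

(* Balls are open: [ball x r = [set y | mdist x y < r]]. *)
Definition doubling (M : metricType R) : Prop :=
  exists D : nat, forall r : R, 0 < r -> forall x : M,
    exists s : seq M, (size s <= D)%N /\
      ball x (2 * r) `<=` \bigcup_(c in [set` s]) ball c r.

Definition isometry (M M' : metricType R) (f : M -> M') : Prop :=
  forall x y, mdist (f x) (f y) = mdist x y.

Definition isometric (M M' : metricType R) : Prop :=
  exists f : M -> M', bijective f /\ isometry f.

Definition C_isometric_embedding (C : R) (M M' : metricType R)
    (f : M -> M') : Prop :=
  injective f /\
  forall x y, C^-1 * mdist x y <= mdist (f x) (f y) <= C * mdist x y.

Definition bounded_geometry_with (n : nat) (r C : R) (M : metricType R) :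
    Prop :=
  forall x : M, exists f : set_type (ball x r) -> euclidean R n,
    C_isometric_embedding C f.

Definition bounded_geometry (M : metricType R) : Prop :=
  exists (n : nat) (r C : R),
    [/\ 0 < r, 1 <= C & bounded_geometry_with n r C M].

(* The values of the curve outside [0, a] are irrelevant. *)
Definition geodesic_segment (M : metricType R) (x y : M) (A : set M) : Prop :=
  exists (a : R) (g : R -> M),
    [/\ 0 <= a, g 0 = x, g a = y,
        {in `[0, a] &, forall t s, mdist (g t) (g s) = `|t - s|} &
        A = g @` `[0, a]].

Definition geodesic_space (M : metricType R) : Prop :=
  forall x y : M, exists A, geodesic_segment x y A.

(* Closed neighbourhood, so that delta = 0 is meaningful. *)
Definition neighbourhood (M : metricType R) (delta : R) (A : set M) : set M :=
  [set p | exists2 q, A q & mdist p q <= delta].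

Definition delta_hyperbolic (delta : R) (M : metricType R) : Prop :=
  geodesic_space M /\
  forall (x y z : M) (A B C : set M),
    geodesic_segment x y A -> geodesic_segment y z B ->
    geodesic_segment z x C ->
    [/\ A `<=` neighbourhood delta (B `|` C),
        B `<=` neighbourhood delta (C `|` A) &
        C `<=` neighbourhood delta (A `|` B)].

Definition gromov_hyperbolic (M : metricType R) : Prop :=
  exists2 delta : R, 0 <= delta & delta_hyperbolic delta M.

End metric_notions.

Section lipschitz_space.
Context {R : realType} (M : metricType R) (X : normedModType R).

Definition lipschitz_pred : {pred M -> X} :=
  mem [set f : M -> X |
    exists k : R, forall x y, `|f x - f y| <= k * mdist x y].

Record Lip := MkLip { lip_fun :> M -> X ; _ : lip_fun \in lipschitz_pred }.

HB.instance Definition _ := [isSub for lip_fun].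
HB.instance Definition _ := gen_eqMixin Lip.
HB.instance Definition _ := gen_choiceMixin Lip.

Let lipschitz_submod_closed : submod_closed lipschitz_pred.
Proof.
split=> [|a f g]; rewrite !inE /=.
  by exists 0 => x y; rewrite subrr normr0 mul0r.
move=> [k fk] [l gl]; exists (`|a| * k + l) => x y.
rewrite opprD addrACA -scalerBr mulrDl -mulrA.
by rewrite (le_trans (ler_normD _ _))// lerD// normrZ ler_wpM2l.
Qed.

HB.instance Definition _ := GRing.isSubmodClosed.Build _ _ lipschitz_pred
  lipschitz_submod_closed.
HB.instance Definition _ := [SubChoice_isSubLmodule of Lip by <:].

(* The set is bounded above since f is Lipschitz; when M has at most one point
   it is empty, and sup set0 = 0 as wanted. *)
Definition lip_norm (f : Lip) : R :=
  sup [set `|f p.1 - f p.2| / mdist p.1 p.2 | p in [set p : M * M | p.1 <> p.2]].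

End lipschitz_space.

Section extension.
Context {R : realType} (M : metricType R) (S : set M) (X : normedModType R).

(* Continuity for the topologies defined by the seminorms. *)
Definition lip_continuous (T : Lip S X -> Lip M X) : Prop :=
  forall f (e : R), 0 < e -> exists2 d : R, 0 < d &
    forall g, lip_norm (g - f) < d -> lip_norm (T g - T f) < e.

Definition Ext : set {linear Lip S X -> Lip M X} :=
  [set T | lip_continuous T /\ forall f (s : S), T f (set_val s) = f s].

Definition lip_opnorm (T : Lip S X -> Lip M X) : \bar R :=
  ereal_sup [set (lip_norm (T f))%:E | f in [set f | lip_norm f <= 1]].

Definition ext_constant : \bar R := ereal_inf [set lip_opnorm T | T in Ext].

End extension.

Definition universal (R : realType) (U : metricType R) : Prop :=
  exists c : R, forall (M : metricType R) (S : set M),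
    (exists V : set U, isometric S V) ->
    forall X : completeNormedModType R, (ext_constant S X <= c%:E)%E.

(* Main.v *)
Require Import Defs.
From HB Require Import structures.
From mathcomp Require Import all_boot all_order all_algebra.
From mathcomp Require Import all_classical all_reals all_analysis.
From mathcomp Require Import ring lra zify.

Set Implicit Arguments.
Unset Strict Implicit.
Unset Printing Implicit Defensive.

Import Order.TTheory GRing.Theory Num.Theory.
Import numFieldNormedType.Exports.

Local Open Scope classical_set_scope.
Local Open Scope ring_scope.

(** Every space in the statement has at each scale r > 0 a partition into cells
    of diameter O(r) such that an r-ball meets only boundedly many cells, both
    bounds being independent of r (in other words, its Nagata dimension is
    finite).  This property, [partitionable], passes to subspaces and to finite
    direct sums, and it is all that an extension theorem needs.

    A doubling space has it because the cells can be taken around the points of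
    a maximal r-separated set ([doubling_partitionable]).  For a hyperbolic
    space of bounded geometry ([hyperbolic_partitionable]) the same works at
    small scales, where balls look like subsets of a Euclidean space.  At large
    scales one cuts the space into the annuli k r <= d(o, y) < (k + 1) r around
    a base point o, and sorts the points y of an annulus by the place where a
    geodesic from o to y crosses the sphere of radius (k - 1) r.  Two points of
    an annulus at distance at most 2 r have their geodesics still 4 delta close
    on that sphere ([slim_fellow_travel]), so the places seen from an r-ball lie
    in a ball of fixed radius, which contains a bounded number of net points.

    Now let S be a subset of M with such partitions.  For x off the
    closure of S put rho = d(x, S) and average a function f on S over the cells
    of scale comparable to rho that are close to x, with weights that are
    1-Lipschitz in x.  At each x at most 3 D weights are nonzero, D being the
    bound on the number of cells, and they sum to at least rho / 2, while all
    the cells involved lie at distance O(rho).  Hence moving x by d changes the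
    average by O(d / rho) O(rho) = O(d) when d is small compared with rho
    ([average_diff]).  When d is large it suffices that the extension at x
    differs from f(s) by O(d(x, s)) for all s in S ([extend_near]).  The same
    estimate shows that the extension agrees with f on S.  On the closure of S
    the extension is the limit of f, which exists since X is complete. *)

(** * Partitions with bounded multiplicity *)

Section partitions.
Context {R : realType}.
Implicit Types V W : metricType R.

(** The cells are the fibres of p.  That a ball of radius r meets at most #|T|
    of them is expressed by a colouring of the ball in T which determines the
    cell; in this form the condition restricts to subspaces and multiplies in
    products without any counting. *)
Definition cell_map V (T : finType) (C r : R) (I : Type) (p : V -> I) : Prop :=
  (forall x y, p x = p y -> mdist x y <= C * r) /\
  forall x, exists c : V -> T, forall y y',
    mdist x y <= r -> mdist x y' <= r -> c y = c y' -> p y = p y'.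

Definition partitionable V : Prop :=
  exists (C : R) (T : finType), 0 <= C /\
    forall r : R, 0 < r -> exists p : V -> V, cell_map T C r p.

(** Choosing a point in each cell turns the labels into points of the space,
    at which functions on the space can be evaluated. *)
Lemma cell_map_rep V T C r (I : Type) (p : V -> I) : cell_map T C r p ->
  exists q : V -> V, cell_map T C r q /\ forall x, mdist x (q x) <= C * r.
Proof.
move=> [fib code].
pose q x := xget x [set y | p y = p x].
have pq x : p (q x) = p x.
  by rewrite /q; apply: (@xgetPex _ x [set y | p y = p x]); exists x.
have qE x y : p x = p y -> q x = q y.
  move=> pxy; rewrite /q pxy /xget; case: pselect => // nex.
  by case: nex; exists y; apply/asboolP.
exists q; split; last by move=> x; apply: fib; rewrite pq.
split=> [x y qxy|x]; first by apply: fib; rewrite -pq qxy pq.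
have [c cP] := code x; exists c => y y' xy xy' cyy'.
exact/qE/cP.
Qed.

Lemma cell_map_isometry V W (g : W -> V) (T : finType) (C r : R) (I : Type)
    (p : V -> I) : Defs.isometry g -> cell_map T C r p -> cell_map T C r (p \o g).
Proof.
move=> giso [fib code]; split=> [x y /fib|x]; first by rewrite giso.
have [c cP] := code (g x); exists (c \o g) => y y'; rewrite -!giso.
exact: cP.
Qed.

Lemma direct_sum_dist_le (N : nat) (M : 'I_N -> metricType R)
    (x y : direct_sum M) (r : R) : 0 <= r ->
  (mdist x y <= r) <-> forall i, mdist (x i) (y i) <= r.
Proof.
move=> r0; split=> [xyr i|xyr].
  by apply: le_trans xyr; exact: (le_bigmax _ (fun i => mdist (x i) (y i))).
by apply: bigmax_le.
Qed.

(** The products of cells are the cells of the sum; the multiplicity bounds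
    multiply, since a ball for the maximum metric is a product of balls. *)
Lemma partitionable_direct_sum (N : nat) (M : 'I_N -> metricType R) :
  (forall i, partitionable (M i)) -> partitionable (direct_sum M).
Proof.
move=> /choice[C] /choice[T] CT.
have C0 i : 0 <= C i by have [] := CT i.
have Cle i : C i <= \big[Num.max/0]_i C i by exact: le_bigmax.
exists (\big[Num.max/0]_i C i), {dffun forall i, T i}.
split=> [|r r0]; first exact: bigmax_ge_id.
pose p i := projT1 (cid ((CT i).2 r r0)).
have pP i : cell_map (T i) (C i) r (p i) by exact: projT2 (cid ((CT i).2 r r0)).
exists (fun x i => p i (x i)); split=> [x y pxy|x].
  apply/direct_sum_dist_le => [|i].
    by rewrite mulr_ge0// ?bigmax_ge_id// ltW.
  rewrite (le_trans ((pP i).1 _ _ _))// ?ler_wpM2r ?(ltW r0)//.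
  by rewrite -[LHS]/((fun i => p i (x i)) i) pxy.
pose c i := projT1 (cid ((pP i).2 (x i))).
have cP i := projT2 (cid ((pP i).2 (x i))).
exists (fun y => [ffun i => c i (y i)]) => y y'.
move=> /(direct_sum_dist_le _ _ (ltW r0)) xy /(direct_sum_dist_le _ _ (ltW r0)) xy' cyy'.
apply: functional_extensionality_dep => i; apply: (cP i) => //.
by have := congr1 (fun f : {dffun forall i, T i} => f i) cyy'; rewrite !ffunE.
Qed.

Definition separated V (r : R) (A : set V) :=
  forall a b, A a -> A b -> mdist a b < r -> a = b.

Lemma maximal_separated V (r : R) : 0 < r ->
  exists A : set V, separated r A /\ forall x, exists2 a, A a & mdist x a < r.
Proof.
move=> r0; pose S := {A : set V | separated r A}.
have [A Amax] : exists A : S, forall B : S, `[< sval A `<=` sval B >] -> B = A.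
  apply: (@Zorn S (fun A B => `[< sval A `<=` sval B >])).
  - by move=> A; exact/asboolP.
  - by move=> A B C /asboolP AB /asboolP BC; apply/asboolP => x /AB /BC.
  - move=> [A hA] [B hB] /asboolP/= AB /asboolP/= BA.
    by apply: eq_exist; apply/seteqP; split.
  - move=> F Ftot.
    have Usep : separated r (\bigcup_(A in F) sval A).
      move=> a b [A FA Aa] [B FB Bb].
      have [/asboolP AB|/asboolP BA] := Ftot _ _ FA FB.
        by apply: (svalP B) => //; exact: AB.
      by apply: (svalP A) => //; exact: BA.
    by exists (exist _ _ Usep) => A FA; apply/asboolP => x Ax; exists A.
exists (sval A); split=> [|x]; first exact: svalP A.
apply: contrapT => nex.
have far a : sval A a -> r <= mdist x a.
  by move=> Aa; rewrite leNgt; apply/negP => xa; apply: nex; exists a.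
have Bsep : separated r (sval A `|` [set x]).
  move=> a b [Aa|->] [Ab|->]//; first exact: (svalP A).
  - by rewrite metric_sym ltNge far.
  - by rewrite ltNge far.
have BA := Amax (exist _ _ Bsep) (asboolT (@subsetUl _ _ _)).
have Ax : sval A x by rewrite -BA /=; right.
by have := far x Ax; rewrite mdistxx leNgt r0.
Qed.

(** The balls of radius s are covered by the balls of radius t around the
    family z; indexing the family by T makes covers compose by products of
    index types. *)
Definition ball_cover V (T : Type) (s t : R) : Prop :=
  forall x : V, exists z : T -> V, forall y, mdist x y < s ->
    exists i, mdist (z i) y < t.

Lemma ball_cover_trans V T T' s t u :
  ball_cover V T s t -> ball_cover V T' t u -> ball_cover V (T * T')%type s u.
Proof.
move=> st tu x; have [z zP] := st x.
have /choice[w wP] := fun i => tu (z i).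
exists (fun ij => w ij.1 ij.2) => y /zP[i /wP[j ij]]; by exists (i, j).
Qed.

(** A ball of radius t contains at most one point of A, so the index of a
    covering ball determines the point. *)
Lemma ball_cover_separated V T s t (A : set V) (x : V) : 0 < s ->
  ball_cover V T s t -> separated (2 * t) A ->
  exists c : V -> T, forall y y', A y -> A y' -> mdist x y < s ->
    mdist x y' < s -> c y = c y' -> y = y'.
Proof.
move=> s0 cov Asep; have [z zP] := cov x.
have [|i0 _] := zP x; first by rewrite mdistxx.
have /choice[c cP] : forall y, exists i, mdist x y < s -> mdist (z i) y < t.
  move=> y; have [/zP[i zi]|nxy] := pselect (mdist x y < s); first by exists i.
  by exists i0.
exists c => y y' Ay Ay' xy xy' cyy'; apply: Asep => //.
have := cP _ xy; have := cP _ xy'; rewrite -cyy' => h' h.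
have := metric_triangle y (z (c y)) y'; rewrite (metric_sym y (z _)); lra.
Qed.

(** The cells are formed by sending each point to a nearby point of a maximal
    r-separated set.  An r-ball only sees net points in the ball of radius 2 r,
    and r / 2 is the covering radius that separates them. *)
Lemma ball_cover_cell_map V (T : finType) (r : R) : 0 < r ->
  ball_cover V T (2 * r) (r / 2) -> exists p : V -> V, cell_map T 2 r p.
Proof.
move=> r0 cov; have [A [Asep Anet]] := maximal_separated V r0.
have /choice[p pP] : forall x, exists a, A a /\ mdist x a < r.
  by move=> x; have [a] := Anet x; exists a.
exists p; split=> [x y pxy|x].
  have := (pP x).2; have := (pP y).2; rewrite pxy (metric_sym y (p y)) => h h'.
  have := metric_triangle x (p y) y; lra.
have [||c cP] := ball_cover_separated x _ cov (A := A); first by rewrite mulr_gt0.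
  by rewrite mulrCA divff ?mulr1 ?pnatr_eq0.
exists (c \o p) => y y' xy xy'; apply: cP; try exact: (pP _).1.
- have := metric_triangle x y (p y); have := (pP y).2; lra.
- have := metric_triangle x y' (p y'); have := (pP y').2; lra.
Qed.

Lemma doubling_partitionable V : doubling V -> partitionable V.
Proof.
move=> [D dbl].
have cov t : 0 < t -> ball_cover V 'I_D.+1 (2 * t) t.
  move=> t0 x; have [s [sD sP]] := dbl t t0 x.
  exists (fun i => nth x s i) => y xy.
  have /sP[c /= cs] : ball x (2 * t) y by rewrite ballEmdist.
  rewrite ballEmdist /= => cy.
  have ci : (index c s < D.+1)%N.
    by rewrite ltnS (leq_trans _ sD)// ltnW// index_mem.
  by exists (Ordinal ci); rewrite /= nth_index.
exists 2, ('I_D.+1 * 'I_D.+1)%type; split=> // r r0.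
apply: ball_cover_cell_map => //; apply: ball_cover_trans (cov r r0) _.
have -> : r = 2 * (r / 2) by rewrite mulrCA divff ?mulr1 ?pnatr_eq0.
by rewrite mulrAC divff ?pnatr_eq0// mul1r; apply: cov; rewrite divr_gt0.
Qed.

End partitions.

(** * Covering small balls under bounded geometry *)

Section bounded_geometry.
Context {R : realType}.
Implicit Types V : metricType R.

Lemma coord_le_dist n (a b : euclidean R n) i :
  `|(a : 'rV[R]_n) 0 i - (b : 'rV[R]_n) 0 i| <= mdist a b.
Proof.
rewrite -sqrtr_sqr; apply: ler_wsqrtr.
by rewrite (bigD1 i)//= lerDl sumr_ge0// => j _; exact: sqr_ge0.
Qed.

Lemma dist_lt_coord n (a b : euclidean R n) (h : R) : 0 < h ->
  (forall i, `|(a : 'rV[R]_n) 0 i - (b : 'rV[R]_n) 0 i| < h) ->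
  mdist a b < n.+1%:R * h.
Proof.
move=> h0 ab.
have n1h : 0 <= n.+1%:R * h by rewrite mulr_ge0 ?ler0n ?ltW.
rewrite -(ger0_norm n1h) -sqrtr_sqr ltr_sqrt; last first.
  by rewrite exprn_gt0// mulr_gt0 ?ltr0n.
apply: (@le_lt_trans _ _ (\sum_(i < n) h ^+ 2)).
  apply: ler_sum => i _; rewrite -real_normK ?num_real//.
  by rewrite lerXn2r ?nnegrE// ?ltW.
rewrite sumr_const card_ord -[_ *+ n]mulr_natl exprMn ltr_pM2r ?exprn_gt0//.
by rewrite -natrX ltr_nat leq_pmulr.
Qed.

(** The colour of b is the grid cube of side h containing b, counted from a;
    the number of colours depends on the ratio L of the radius to h only. *)
Lemma euclidean_grid n (L : R) : exists T : finType,
  forall (h : R) (a : euclidean R n), 0 < h ->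
    exists c : euclidean R n -> T, forall b b',
      mdist a b <= L * h -> mdist a b' <= L * h -> c b = c b' ->
      mdist b b' < n.+1%:R * h.
Proof.
pose K := (Num.truncn `|L|).+1.
exists {ffun 'I_n -> 'I_(2 * K).+1} => h a h0.
pose e (b : euclidean R n) i := ((b : 'rV[R]_n) 0 i - (a : 'rV[R]_n) 0 i) / h + K%:R.
exists (fun b => [ffun i => inord (Num.truncn (e b i))]) => b b' ab ab' cbb'.
have eK u : mdist a u <= L * h -> forall i, 0 <= e u i < (2 * K)%:R.
  move=> au i; have := coord_le_dist u a i; rewrite metric_sym => /le_trans/(_ au).
  have LK : L < K%:R.
    by rewrite (le_lt_trans (ler_norm L))//; case/andP: (truncn_itv (normr_ge0 L)).
  rewrite -ler_pdivrMr// -{1}(gtr0_norm h0) -normf_div => /le_lt_trans/(_ LK).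
  by rewrite ltr_norml /e natrM; set X := (_ / h); move=> /andP[]; lra.
apply: dist_lt_coord => // i.
have /(congr1 val) := congr1 (fun f : {ffun _} => f i) cbb'; rewrite !ffunE /=.
have /andP[e0 eK1] := eK _ ab i; have /andP[e0' eK1'] := eK _ ab' i.
have /andP[t1 t2] := truncn_itv e0; have /andP[t1' t2'] := truncn_itv e0'.
rewrite !inordK; last 2 first.
- by rewrite ltnS -(@ler_nat R) (le_trans t1')// ltW.
- by rewrite ltnS -(@ler_nat R) (le_trans t1)// ltW.
move=> tt; rewrite -tt in t1' t2'.
have : `|e b i - e b' i| < 1.
  by rewrite ltr_norml; move: t1 t2 t1' t2'; rewrite -!natr1; lra.
rewrite /e opprD addrACA subrr addr0 -mulrBl.
rewrite opprB addrA subrK.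
by rewrite normrM normfV (gtr0_norm h0) ltr_pdivrMr// mul1r.
Qed.

(** Pull back a Euclidean grid of mesh proportional to t along the chart of the
    ball of radius r around x, and choose a point in each cube that is hit.  The
    distortion C costs a factor C ^+ 2 in the ratio of radius to mesh, and the
    comparison of coordinates with the Euclidean norm a factor n.+1. *)
Lemma bounded_geometry_cover V n r C : 1 <= C -> bounded_geometry_with n r C V ->
  exists T : finType, forall t, 0 < t -> 4 * t <= r -> ball_cover V T (4 * t) t.
Proof.
move=> C1 bg; have C0 : 0 < C by rewrite (lt_le_trans _ C1).
have [T TP] := euclidean_grid n (4 * C ^+ 2 * n.+1%:R).
exists T => t t0 tr x; have [f [_ fC]] := bg x.
have r0 : 0 < r by lra.
have xx : ball x r x by rewrite ballEmdist /= mdistxx.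
pose ox : set_type (ball x r) := exist _ x (mem_set xx).
have h0 : 0 < t / (C * n.+1%:R) by rewrite divr_gt0// mulr_gt0.
have [c cP] := TP _ (f ox) h0.
have Lh : 4 * C ^+ 2 * n.+1%:R * (t / (C * n.+1%:R)) = C * (4 * t).
  by field; rewrite nat1r pnatr_eq0 (gt_eqF C0).
have nh : n.+1%:R * (t / (C * n.+1%:R)) = C^-1 * t.
  by field; rewrite nat1r pnatr_eq0 (gt_eqF C0).
rewrite Lh nh in cP.
have /choice[z zP] : forall i : T, exists z : V, forall y : set_type (ball x r),
    mdist x (val y) < 4 * t -> c (f y) = i -> mdist z (val y) < t.
  move=> i; have [[y [xy cy]]|nex] := pselect (exists y : set_type (ball x r),
      mdist x (val y) < 4 * t /\ c (f y) = i); last first.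
    by exists x => y xy cy; case: nex; exists y.
  exists (val y) => y' xy' cy'.
  have fxy u : mdist x (val u) < 4 * t -> mdist (f ox) (f u) <= C * (4 * t).
    move=> /ltW xu; have /andP[_ /le_trans] := fC ox u; apply.
    by rewrite ler_pM2l.
  have := cP _ _ (fxy _ xy) (fxy _ xy'); rewrite cy cy' => /(_ erefl) fyy'.
  have /andP[/le_lt_trans/(_ fyy')] := fC y y'.
  by rewrite ltr_pM2l ?invr_gt0.
exists z => y xy.
have ry : ball x r y by rewrite ballEmdist /=; lra.
pose oy : set_type (ball x r) := exist _ y (mem_set ry).
by exists (c (f oy)); exact: (zP _ oy).
Qed.

End bounded_geometry.

(** * Slim geodesic triangles *)

Section hyperbolic.
Context {R : realType}.
Implicit Types V : metricType R.

Definition unit_speed V (g : R -> V) (a : R) :=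
  {in `[0, a] &, forall t s, mdist (g t) (g s) = `|t - s|}.

Lemma unit_speed_segment V (g : R -> V) a : 0 <= a -> unit_speed g a ->
  geodesic_segment (g 0) (g a) (g @` `[0, a]).
Proof. by move=> a0 ga; exists a, g. Qed.

Lemma unit_speed_rev V (g : R -> V) a :
  unit_speed g a -> unit_speed (fun t => g (a - t)) a.
Proof.
move=> ga t s; rewrite !in_itv /= => /andP[t0 ta] /andP[s0 sa].
rewrite ga ?in_itv /=; last 2 first.
- by apply/andP; split; lra.
- by apply/andP; split; lra.
by rewrite opprB addrC addrA subrK distrC.
Qed.

Lemma geodesic_unit_speed V : geodesic_space V -> forall x y : V,
  exists g : R -> V, [/\ g 0 = x, g (mdist x y) = y & unit_speed g (mdist x y)].
Proof.
move=> geo x y; have [A [a [g [a0 g0 ga gE _]]]] := geo x y.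
have -> : mdist x y = a; last by exists g.
rewrite -g0 -ga gE ?in_itv /= ?lexx ?a0//.
by rewrite sub0r normrN ger0_norm.
Qed.

Lemma unit_speed_from0 V (g : R -> V) a t : unit_speed g a -> 0 <= t <= a ->
  mdist (g 0) (g t) = t.
Proof.
move=> ga /andP[t0 ta]; rewrite ga ?in_itv /= ?lexx ?t0 ?(le_trans t0)//.
by rewrite sub0r normrN ger0_norm.
Qed.

Lemma unit_speed_toend V (g : R -> V) a t : unit_speed g a -> 0 <= t <= a ->
  mdist (g a) (g t) = a - t.
Proof.
move=> ga /andP[t0 ta]; rewrite ga ?in_itv /= ?lexx ?t0 ?(le_trans t0)//.
by rewrite ger0_norm ?subr_ge0.
Qed.

(** Since g t and g' t are at distance at least r from the ends of a third side
    of length at most 2 r, a point of that side which is delta-close to either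
    of them is at a distance between r - delta and r + delta from g a; so if both
    are close to the third side, they are 4 delta-close to each other.  If one
    of them is close to the opposite geodesic instead, comparing distances to
    g 0 shows that they are even 2 delta-close. *)
Lemma slim_fellow_travel V (delta : R) (g g' : R -> V) (a a' r t : R) :
  0 <= delta -> delta_hyperbolic delta V ->
  unit_speed g a -> unit_speed g' a' -> g 0 = g' 0 ->
  0 <= r -> 0 <= t -> t + r <= a -> t + r <= a' -> mdist (g a) (g' a') <= 2 * r ->
  mdist (g t) (g' t) <= 4 * delta.
Proof.
move=> d0 [geo slim] ga ga' gg' r0 t0 ta ta' dr.
have [h [h0 hb hh]] := geodesic_unit_speed geo (g a) (g' a').
set b := mdist (g a) (g' a') in h0 hb hh dr.
have b0 : 0 <= b by exact: mdist_ge0.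
have a0 : 0 <= a by lra.
have a0' : 0 <= a' by lra.
have sA := unit_speed_segment a0 ga.
have sB := unit_speed_segment b0 hh; rewrite h0 hb in sB.
have sC := unit_speed_segment a0' (unit_speed_rev ga'); rewrite subr0 subrr -gg' in sC.
have [slimA _ slimC] := slim _ _ _ _ _ _ sA sB sC.
have [g0t gat] : mdist (g 0) (g t) = t /\ mdist (g a) (g t) = a - t.
  by split; [apply: (unit_speed_from0 ga)|apply: (unit_speed_toend ga)];
     apply/andP; split; lra.
have [g0t' gat'] : mdist (g' 0) (g' t) = t /\ mdist (g' a') (g' t) = a' - t.
  by split; [apply: (unit_speed_from0 ga')|apply: (unit_speed_toend ga')];
     apply/andP; split; lra.
rewrite -gg' in g0t'.
have [p [[u]|[u]] + <- gp] : neighbourhood delta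
    (h @` `[0, b] `|` (fun t => g' (a' - t)) @` `[0, a']) (g t).
- by apply: slimA; exists t => //; rewrite /= in_itv /=; apply/andP; split; lra.
- rewrite /= in_itv /= => ub.
  have [p' [[v]|[v]] + <- gp'] : neighbourhood delta
      (g @` `[0, a] `|` h @` `[0, b]) (g' t).
  + apply: slimC; exists (a' - t); last by rewrite subKr.
    by rewrite /= in_itv /=; apply/andP; split; lra.
  + rewrite /= in_itv /= => va.
    have g0v := unit_speed_from0 ga va.
    have gtv : mdist (g t) (g v) = `|t - v|.
      by apply: ga => //; rewrite in_itv /=; apply/andP; split; lra.
    have := metric_triangle (g t) (g v) (g' t).
    have := metric_triangle (g 0) (g v) (g' t).
    have := metric_triangle (g 0) (g' t) (g v).
    rewrite (metric_sym (g v)) gtv.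
    have : `|t - v| = t - v \/ `|t - v| = v - t.
      by have [tv|tv] := leP v t; [left|right; rewrite distrC];
         rewrite ger0_norm ?subr_ge0// ltW.
    by move=> []->; lra.
  + rewrite /= in_itv /= => vb.
    have h0u := unit_speed_from0 hh ub; have hbu := unit_speed_toend hh ub.
    have h0v := unit_speed_from0 hh vb; have hbv := unit_speed_toend hh vb.
    rewrite h0 in h0u h0v; rewrite hb in hbu hbv.
    have huv : mdist (h u) (h v) = `|u - v| by apply: hh; rewrite in_itv.
    have u1 : r - delta <= u.
      have := metric_triangle (g a) (h u) (g t); rewrite (metric_sym (h u)); lra.
    have g0ga := unit_speed_from0 ga (t := a).
    have g0ga' := unit_speed_from0 ga' (t := a').
    rewrite a0 lexx in g0ga; rewrite a0' lexx -gg' in g0ga'.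
    have u2 : u <= r + delta.
      have := metric_triangle (g 0) (g t) (h u).
      have := metric_triangle (g 0) (h u) (g' a').
      rewrite (metric_sym (h u)) hbu g0ga'//; lra.
    have v1 : v <= r + delta.
      have := metric_triangle (g' a') (h v) (g' t); rewrite (metric_sym (h v)); lra.
    have v2 : r - delta <= v.
      have := metric_triangle (g 0) (g' t) (h v).
      have := metric_triangle (g 0) (h v) (g a).
      rewrite (metric_sym (h v)) h0v g0ga//; lra.
    have uv : `|u - v| <= 2 * delta by rewrite ler_norml; apply/andP; split; lra.
    have := metric_triangle (g t) (h u) (g' t).
    have := metric_triangle (h u) (h v) (g' t).
    by rewrite (metric_sym (h v)) huv; lra.
- rewrite /= in_itv /= => ua.
  have va : 0 <= a' - u <= a' by apply/andP; split; lra.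
  move: gp va; move: (a' - u) => v gp va.
  have g0v := unit_speed_from0 ga' va.
  have gtv : mdist (g' t) (g' v) = `|t - v|.
    by apply: ga' => //; rewrite in_itv /=; apply/andP; split; lra.
  rewrite -gg' in g0v.
  have := metric_triangle (g t) (g' v) (g' t).
  have := metric_triangle (g 0) (g' v) (g t).
  have := metric_triangle (g 0) (g t) (g' v).
  rewrite (metric_sym (g' v) (g t)) (metric_sym (g' v) (g' t)) gtv.
  have : `|t - v| = t - v \/ `|t - v| = v - t.
    by have [tv|tv] := leP v t; [left|right; rewrite distrC];
       rewrite ger0_norm ?subr_ge0// ltW.
  by move=> []->; lra.
Qed.

End hyperbolic.

(** * Partitions of hyperbolic spaces *)

Section hyperbolic_partition.
Context {R : realType}.
Implicit Types V : metricType R.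

(** A point outside a ball is reached by walking back along a geodesic to the
    base point, so a cover of a ball by u-balls grows by u in radius each time
    its u-balls are replaced by 4 u-balls and these are covered again. *)
Lemma geodesic_ball_cover V (T0 : finType) (u s : R) : geodesic_space V ->
  0 < u -> ball_cover V T0 (4 * u) u -> exists T : finType, ball_cover V T s u.
Proof.
move=> geo u0 cov.
suff [T hT] : exists T : finType,
    ball_cover V T ((Num.truncn `|s / u|).+1%:R * u) u.
  exists T => x; have [z zP] := hT x; exists z => y xy; apply: zP.
  rewrite (lt_trans xy)// -ltr_pdivrMr// (le_lt_trans (ler_norm _))//.
  by case/andP: (truncn_itv (normr_ge0 (s / u))).
elim: (Num.truncn _) => [|n [T IH]].
  by exists unit => x; exists (fun=> x) => y; rewrite mul1r; exists tt.
exists (T * T0)%type.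
apply: (@ball_cover_trans _ _ _ _ _ (4 * u)) cov => x.
have [z zP] := IH x; exists z => y xy.
have [g [g0 gy gE]] := geodesic_unit_speed geo x y.
pose w := Num.max 0 (mdist x y - u).
have w01 : 0 <= w <= mdist x y.
  by rewrite /w le_max lexx /= ge_max mdist_ge0 /= gerBl ltW.
have xw : mdist x (g w) = w by rewrite -{1}g0; exact: unit_speed_from0 gE w01.
have yw : mdist y (g w) = mdist x y - w.
  by rewrite -{1}gy; exact: unit_speed_toend gE w01.
have wle : mdist x y - w <= u.
  by have : mdist x y - u <= w by [rewrite le_max lexx orbT]; lra.
have [|i iP] := zP (g w).
  rewrite xw /w gt_max mulr_gt0 ?ltr0n//=; move: xy.
  by rewrite -[n.+2%:R]natr1 mulrDl mul1r; lra.
exists i; have := metric_triangle (z i) (g w) y.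
by rewrite (metric_sym (g w)) yw; lra.
Qed.

(** The label of y consists of the index k of its annulus and of a point q of a
    2 u-separated net close to the point a(y) at distance (k - 1) r from o on a
    geodesic from o to y.  In a ball of radius r only three values of k occur,
    and for each of them the points a(y) are 4 delta-close to each other, so that
    the number of values of q is bounded by the size of a cover of one ball of
    radius 4 delta + 4 u. *)
Lemma annuli_partition V (T : finType) (delta u r : R) (o : V) :
  0 <= delta -> delta_hyperbolic delta V -> 0 < u -> u <= r ->
  ball_cover V T (4 * delta + 4 * u) u ->
  exists p : V -> nat * V, @cell_map _ V ('I_3 * T)%type 8 r _ p.
Proof.
move=> d0 hyp u0 ur cov; have [geo _] := hyp.
have r0 : 0 < r by exact: lt_le_trans ur.
have /choice[g gP] := geodesic_unit_speed geo o.
have uu : 0 < 2 * u by rewrite mulr_gt0.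
have [A [Asep Anet]] := maximal_separated V uu.
have /choice[q qP] : forall y, exists a, A a /\ mdist y a < 2 * u.
  by move=> y; have [a] := Anet y; exists a.
have [i0 _] : exists i : T, True.
  have [z zP] := cov o; have [|i _] := zP o; last by exists i.
  by rewrite mdistxx; lra.
pose k y := Num.truncn (mdist o y / r).
have kP y : (k y)%:R * r <= mdist o y < (k y).+1%:R * r.
  by rewrite -ler_pdivlMr// -ltr_pdivrMr// truncn_itv// divr_ge0 ?mdist_ge0// ltW.
(* In the innermost disc, where k = 0, the truncated predecessor makes t = 0. *)
pose t y := (k y).-1%:R * r.
have tP y : [/\ 0 <= t y, t y <= mdist o y,
    mdist o y - t y <= 2 * r & (t y = 0 \/ t y + r <= mdist o y)].
  have := kP y; rewrite /t; case: (k y) => [|n]; rewrite -!natr1 /= => /andP[h1 h2].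
    rewrite mul0r; split; [by []|exact: mdist_ge0|lra|by left].
  have n0 : 0 <= n%:R * r by rewrite mulr_ge0 ?ler0n// ltW.
  by split=> //; move: h1 h2; rewrite !mulrDl !mul1r; lra.
pose a y := g y (t y).
have ya y : mdist y (a y) <= 2 * r.
  have [t0 td tr _] := tP y; have [_ gy gE] := gP y.
  rewrite -{1}gy (unit_speed_toend gE) ?tr//; exact/andP.
have aa y y' : k y = k y' -> mdist y y' <= 2 * r -> mdist (a y) (a y') <= 4 * delta.
  move=> kk yy'; have tt : t y = t y' by rewrite /t kk.
  have [t0 _ _ h] := tP y; have [_ _ _ h'] := tP y'; rewrite /a -tt.
  have [g0 gy gE] := gP y; have [g0' gy' gE'] := gP y'.
  have [ty0|ty] := eqVneq (t y) 0.
    by rewrite ty0 g0 g0' mdistxx mulr_ge0.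
  apply: (@slim_fellow_travel _ V _ _ _ (mdist o y) (mdist o y') r) => //.
  - by rewrite g0 g0'.
  - exact: ltW.
  - by case: h => // ty0; rewrite ty0 eqxx in ty.
  - by rewrite tt in ty *; case: h' => // ty0; rewrite ty0 eqxx in ty.
  - by rewrite gy gy'.
exists (fun y => (k y, q (a y))); split=> [y y' [kk qq]|x].
  have := ya y; have := ya y'; have := (qP (a y)).2; have := (qP (a y')).2; rewrite -qq.
  have := metric_triangle y (a y) y'.
  have := metric_triangle (a y) (q (a y)) y'.
  have := metric_triangle (q (a y)) (a y') y'.
  rewrite (metric_sym (q (a y)) (a y')) (metric_sym (a y') y'); lra.
(* The index j = 0, 1, 2 stands for the annulus k x - 1, k x, k x + 1. *)
have /choice[z zP] : forall j : 'I_3, exists z : T -> V, forall y,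
    mdist x y <= r -> (k y).+1 = (k x + j)%N -> exists i, mdist (z i) (q (a y)) < u.
  move=> j; have [[y [xy ky]]|nex] := pselect (exists y,
      mdist x y <= r /\ (k y).+1 = (k x + j)%N); last first.
    by exists (fun=> x) => y xy ky; case: nex; exists y.
  have [z zP] := cov (q (a y)); exists z => y' xy' ky'; apply: zP.
  have : mdist (a y) (a y') <= 4 * delta.
    apply: aa; first by apply: succn_inj; rewrite ky ky'.
    by have := metric_triangle y x y'; rewrite (metric_sym y x); lra.
  have := (qP (a y)).2; have := (qP (a y')).2.
  have := metric_triangle (q (a y)) (a y) (q (a y')).
  have := metric_triangle (a y) (a y') (q (a y')).
  rewrite (metric_sym (q (a y)) (a y)); lra.
have /choice[c cP] : forall y, exists ji : 'I_3 * T, mdist x y <= r ->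
    (k y).+1 = (k x + ji.1)%N /\ mdist (z ji.1 ji.2) (q (a y)) < u.
  move=> y; have [xy|nxy] := pselect (mdist x y <= r); last first.
    by exists (ord0, i0).
  have [/andP[kx kx'] /andP[ky ky']] := (kP x, kP y).
  have k1 : (k x < (k y).+2)%N.
    rewrite -(ltr_nat R) -(ltr_pM2r r0) -natr1 mulrDl mul1r.
    have := metric_triangle o y x; rewrite (metric_sym y x); lra.
  have k2 : (k y < (k x).+2)%N.
    rewrite -(ltr_nat R) -(ltr_pM2r r0) -natr1 mulrDl mul1r.
    have := metric_triangle o x y; lra.
  have j3 : ((k y).+1 - k x < 3)%N by rewrite ltnS leq_subLR addn2.
  have ky1 : (k y).+1 = (k x + Ordinal j3)%N by rewrite /= subnKC.
  by have [i iP] := zP _ _ xy ky1; exists (Ordinal j3, i).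
exists c => y y' xy xy' cyy'.
have [ky zy] := cP y xy; have [ky' zy'] := cP y' xy'; rewrite -cyy' in ky' zy'.
congr pair; first by apply: succn_inj; rewrite ky ky'.
apply: Asep; [exact: (qP _).1|exact: (qP _).1|].
have := metric_triangle (q (a y)) (z (c y).1 (c y).2) (q (a y')).
by rewrite (metric_sym (q (a y)) (z _ _)); lra.
Qed.

(** The scale r0 / 4 separates the two regimes: below it the charts of radius r0
    give the covers, above it the annuli do. *)
Lemma hyperbolic_partitionable V :
  gromov_hyperbolic V -> bounded_geometry V -> partitionable V.
Proof.
move=> [delta d0 hyp] [n [r0 [C [r00 C1 bg]]]].
have [[b]|V0] := pselect (inhabited V); last first.
  exists 0, unit; split=> // r _; exists id.
  by split=> x; case: V0; exists.
have [T0 cov] := bounded_geometry_cover C1 bg.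
have u0 : 0 < r0 / 4 by rewrite divr_gt0.
have [|T covT] := geodesic_ball_cover (4 * delta + 4 * (r0 / 4)) hyp.1 u0
  (cov _ u0 _); first by lra.
(* A single palette has to serve both regimes. *)
exists 8, (T0 + 'I_3 * T)%type; split=> // r rpos.
have [ur|ru] := leP (r0 / 4) r.
  have [p] := annuli_partition b d0 hyp u0 ur covT.
  move=> /cell_map_rep[q [[qfib qcode] _]]; exists q; split=> // x.
  have [c cP] := qcode x; exists (inr \o c) => y y' xy xy' [] cyy'.
  by apply: cP => //; case: (c y) (c y') cyy' => [? ?] [? ?] /= -> ->.
have [|p [fib code]] := @ball_cover_cell_map _ V T0 r rpos.
  have := cov (r / 2); rewrite divr_gt0// => /(_ isT).
  have -> : 4 * (r / 2) = 2 * r by lra.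
  by apply; lra.
exists p; split=> [x y /fib /le_trans|x]; first by apply; lra.
have [c cP] := code x; exists (inl \o c) => y y' xy xy' [].
exact: cP.
Qed.

End hyperbolic_partition.

(** * Weighted averages in a normed space *)

Section averages.
Context {R : realType} {X : normedModType R}.

Lemma fsbig_support (I : choiceType) (W : nmodType) (F : I -> W) (e : seq I) :
  uniq e -> (forall i, F i != 0 -> i \in e) ->
  \sum_(i \in [set: I]) F i = \sum_(i <- e) F i.
Proof.
move=> ue eP; rewrite (fsbigE e)//=.
  by apply: eq_bigl => i; rewrite in_setT.
by move=> i _; apply: contraNeq => /eP.
Qed.

Definition average (I : Type) (e : seq I) (a : I -> R) (v : I -> X) : X :=
  (\sum_(i <- e) a i)^-1 *: \sum_(i <- e) a i *: v i.

Lemma averageB I (e : seq I) (a : I -> R) (v : I -> X) (w : X) :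
  \sum_(i <- e) a i != 0 ->
  average e a v - w = (\sum_(i <- e) a i)^-1 *: \sum_(i <- e) a i *: (v i - w).
Proof.
move=> A0; under [X in _ = _ *: X]eq_bigr do rewrite scalerBr.
by rewrite sumrB scalerBr -scaler_suml scalerA mulVf// scale1r.
Qed.

Lemma norm_sum_scale_le I (e : seq I) (a : I -> R) (u : I -> X) (l : R) :
  0 <= l -> (forall i, a i != 0 -> `|u i| <= l) ->
  `|\sum_(i <- e) a i *: u i| <= (\sum_(i <- e) `|a i|) * l.
Proof.
move=> l0 ul; rewrite (le_trans (ler_norm_sum _ _ _))// mulr_suml.
apply: ler_sum => i _; rewrite normrZ.
have [->|ai] := eqVneq (a i) 0; first by rewrite normr0 !mul0r.
by rewrite ler_wpM2l// ul.
Qed.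

Lemma average_near I (e : seq I) (a : I -> R) (v : I -> X) (w : X) (l : R) :
  0 <= l -> (forall i, 0 <= a i) -> 0 < \sum_(i <- e) a i ->
  (forall i, a i != 0 -> `|v i - w| <= l) -> `|average e a v - w| <= l.
Proof.
move=> l0 a0 A0 vl; rewrite averageB ?gt_eqF//.
rewrite normrZ normfV (gtr0_norm A0) ler_pdivrMl//.
rewrite (le_trans (norm_sum_scale_le _ l0 vl))//.
by under eq_bigr do rewrite ger0_norm//.
Qed.

(** Subtract w from all values, which changes no difference of averages.  Then
    the two averages differ by the sum of (a i - b i) (v i - w), and by the
    effect of the normalization, which multiplies the second sum, of norm at
    most l times the total of b, by the relative change of the totals.  Both
    contribute at most (size e) d l before dividing by the total of a. *)
Lemma average_diff I (e : seq I) (a b : I -> R) (v : I -> X) (w : X) (d l : R) :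
  0 <= l -> 0 <= d -> (forall i, 0 <= a i) -> (forall i, 0 <= b i) ->
  0 < \sum_(i <- e) a i -> 0 < \sum_(i <- e) b i ->
  (forall i, `|a i - b i| <= d) ->
  (forall i, a i != 0 \/ b i != 0 -> `|v i - w| <= l) ->
  `|average e a v - average e b v| <=
     (2 * (size e)%:R * d * l) / \sum_(i <- e) a i.
Proof.
move=> l0 d0 a0 b0 A0 B0 abd vl.
pose u i := v i - w.
have -> : average e a v - average e b v = (\sum_(i <- e) a i)^-1 *:
    (\sum_(i <- e) (a i - b i) *: u i +
     ((\sum_(i <- e) b i - \sum_(i <- e) a i) / \sum_(i <- e) b i) *:
       \sum_(i <- e) b i *: u i).
  have -> : average e a v - average e b v =
      (average e a v - w) - (average e b v - w) by rewrite opprB addrA subrK.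
  rewrite (averageB v w (lt0r_neq0 A0)) (averageB v w (lt0r_neq0 B0)).
  under [X in _ = _ *: (X + _)]eq_bigr do rewrite scalerBl.
  rewrite sumrB mulrBl divff ?gt_eqF// scalerBl scale1r addrA subrK.
  rewrite scalerBr; congr (_ - _); rewrite scalerA; congr (_ *: _).
  by rewrite mulrA mulVf ?gt_eqF// mul1r.
rewrite normrZ normfV (gtr0_norm A0) mulrC ler_pM2r ?invr_gt0//.
have abn : \sum_(i <- e) `|a i - b i| <= (size e)%:R * d.
  by rewrite mulr_natl -iter_addr_0 -(count_predT e) -big_const_seq; apply: ler_sum.
have -> : 2 * (size e)%:R * d * l = (size e)%:R * d * l + (size e)%:R * d * l by ring.
rewrite (le_trans (ler_normD _ _))// lerD//.
  rewrite (le_trans (norm_sum_scale_le _ l0 _))//; last by rewrite ler_wpM2r.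
  move=> i abi; apply: vl; have [a0i|] := eqVneq (a i) 0; last by left.
  by right; apply: contra_neq abi => b0i; rewrite a0i b0i subrr.
rewrite normrZ normrM normfV (gtr0_norm B0) -[leLHS]mulrA ler_pM//.
- by rewrite mulr_ge0// invr_ge0 ltW.
- rewrite -sumrB (le_trans (ler_norm_sum _ _ _))//.
  by under eq_bigr do rewrite distrC.
rewrite ler_pdivrMl// (le_trans (norm_sum_scale_le _ l0 _))//.
  by move=> i bi; apply: vl; right.
by under eq_bigr do rewrite ger0_norm//.
Qed.
End averages.

(** * The extension operator *)

Section scales.
Context {R : realType}.
Implicit Types k l : int.

(** With ratio e between consecutive scales the logarithm finds the scale of a
    given distance.  The estimates use that the ratio is at least 2. *)
Definition scale k : R := expR k%:~R.

Lemma scale_gt0 k : 0 < scale k. Proof. exact: expR_gt0. Qed.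

Lemma lt_scale k l : (scale k < scale l) = (k < l).
Proof. by rewrite ltr_expR ltr_int. Qed.

Lemma scaleS k : scale (k + 1) = expR 1 * scale k.
Proof. by rewrite /scale intrD expRD mulrC. Qed.

Lemma expR1_ge2 : 2 <= expR 1 :> R.
Proof. by have := @expR_ge1Dx R 1; lra. Qed.

Lemma scale_bracket (t : R) : 0 < t -> exists k, scale k <= t < scale (k + 1).
Proof.
move=> t0; exists (Num.floor (ln t)); have /andP[l1 l2] := floor_itv (ln t).
have tE : expR (ln t) = t by rewrite lnK ?posrE.
by rewrite -[leRHS]tE -[ltLHS]tE /scale ler_expR ltr_expR l1.
Qed.

End scales.

Section distance_to_set.
Context {R : realType} {M : metricType R} (S : set M).

Definition set_dist (x : M) : R := inf [set mdist x (val s) | s in [set: S]].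

Lemma set_dist_le x (s : S) : set_dist x <= mdist x (val s).
Proof.
apply: ge_inf; last by exists s.
by exists 0 => _ [t _ <-]; exact: mdist_ge0.
Qed.

Context (S0 : inhabited S).

Lemma set_dist_ge0 x : 0 <= set_dist x.
Proof.
case: S0 => s; apply: lb_le_inf; first by exists (mdist x (val s)), s.
by move=> _ [t _ <-]; exact: mdist_ge0.
Qed.

Lemma set_dist_lt x a : set_dist x < a -> exists s : S, mdist x (val s) < a.
Proof.
move=> xa; have [||_ [s _ <-]] := @inf_adherent _
    [set mdist x (val s) | s in [set: S]] (a - set_dist x).
- by rewrite subr_gt0.
- case: S0 => s; split; first by exists (mdist x (val s)), s.
  by exists 0 => _ [t _ <-]; exact: mdist_ge0.
- by rewrite -/(set_dist x) addrC subrK => sa; exists s.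
Qed.

Lemma set_dist_lip x y : set_dist x <= set_dist y + mdist x y.
Proof.
rewrite -lerBlDr; apply: lb_le_inf; first by case: S0 => s; exists (mdist y (val s)), s.
move=> _ [s _ <-]; have := set_dist_le x s; have := metric_triangle x y (val s); lra.
Qed.

(** A function supported within distance a of P.  Unlike a formula in the
    distance to P, this supremum vanishes when P is empty, because the supremum
    of the empty set is 0. *)
Definition bump (a : R) (P : set S) (x : M) : R :=
  sup [set Num.max 0 (a - mdist x (val s)) | s in P].

Let bump_ub a (P : set S) x : 0 <= a ->
  has_ubound [set Num.max 0 (a - mdist x (val s)) | s in P].
Proof.
by move=> a0; exists a => _ [s _ <-]; rewrite ge_max a0 /= gerBl mdist_ge0.
Qed.

Lemma bump_ge a (P : set S) x s : 0 <= a -> P s -> a - mdist x (val s) <= bump a P x.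
Proof.
move=> a0 Ps; apply: (@le_trans _ _ (Num.max 0 (a - mdist x (val s)))).
  by rewrite le_max lexx orbT.
by apply: ub_le_sup; [exact: bump_ub|exists s].
Qed.

Lemma bump_le a (P : set S) x b : 0 <= b ->
  (forall s, P s -> a - mdist x (val s) <= b) -> bump a P x <= b.
Proof.
move=> b0 Pb; have [->|/set0P[s Ps]] := eqVneq P set0.
  by rewrite /bump image_set0 sup0.
apply: ge_sup; first by exists (Num.max 0 (a - mdist x (val s))), s.
by move=> _ [t Pt <-]; rewrite ge_max b0 Pb.
Qed.

Lemma bump_ge0 a (P : set S) x : 0 <= a -> 0 <= bump a P x.
Proof.
move=> a0; have [->|/set0P[s Ps]] := eqVneq P set0.
  by rewrite /bump image_set0 sup0.
apply: (@le_trans _ _ (Num.max 0 (a - mdist x (val s)))).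
  by rewrite le_max lexx.
by apply: ub_le_sup; [exact: bump_ub|exists s].
Qed.

Lemma bump_lip a (P : set S) x y : 0 <= a -> bump a P x <= bump a P y + mdist x y.
Proof.
move=> a0; apply: bump_le => [|s Ps]; first by rewrite addr_ge0 ?bump_ge0 ?mdist_ge0.
have := bump_ge y a0 Ps; have := metric_triangle y x (val s).
by rewrite (metric_sym y x); lra.
Qed.

Lemma bump_gt0 a (P : set S) x : 0 < bump a P x ->
  exists2 s, P s & mdist x (val s) < a.
Proof.
move=> b0; apply: contrapT => nex; move: b0; apply/negP; rewrite -leNgt.
apply: bump_le => // s Ps; rewrite subr_le0 leNgt; apply/negP => xs.
by apply: nex; exists s.
Qed.

End distance_to_set.

Section extension_operator.
Context {R : realType} {M : metricType R} (S : set M) (S0 : inhabited S).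
Context (C : R) (C0 : 0 <= C) (T : finType) (p : int -> S -> S).
Context (cells : forall k,
  cell_map T C (3 * scale (k + 2)) (p k) /\
  forall s, mdist s (p k s) <= C * (3 * scale (k + 2))).

Let rho := set_dist S.

(** The index i = (k, q) stands for the cell of representative q at scale k.
    The first two terms of the minimum switch the weight on only when rho x is
    comparable to scale k, the last one only when x is close to the cell. *)
Definition weight (i : int * S) (x : M) : R :=
  Num.max 0 (Num.min (Num.min (rho x - scale (i.1 - 1)) (scale (i.1 + 2) - rho x))
    (bump (2 * scale (i.1 + 1)) [set s | p i.1 s = i.2] x)).

Lemma weight_ge0 i x : 0 <= weight i x.
Proof. by rewrite le_max lexx. Qed.

Lemma weight_lip i x y : `|weight i x - weight i y| <= mdist x y.
Proof.
have onesided u v : weight i u <= weight i v + mdist u v.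
  have a0 : 0 <= 2 * scale (i.1 + 1) :> R by rewrite mulr_ge0 ?ltW ?scale_gt0.
  have := bump_lip [set s | p i.1 s = i.2] u v a0.
  have := set_dist_lip S0 u v; have := set_dist_lip S0 v u.
  rewrite -/rho (metric_sym v u) /weight.
  have := mdist_ge0 u v.
  move: (mdist u v) (bump _ _ u) (bump _ _ v) (rho u) (rho v) => d bu bv ru rv *.
  rewrite ge_max; apply/andP; split; first by rewrite addr_ge0// le_max lexx.
  set m := Num.min _ _.
  have m1 : m <= ru - scale (i.1 - 1) by rewrite !ge_min lexx.
  have m2 : m <= scale (i.1 + 2) - ru by rewrite !ge_min lexx ?orbT.
  have m3 : m <= bu by rewrite !ge_min lexx ?orbT.
  rewrite -lerBlDr le_max !le_min; apply/orP; right.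
  by apply/andP; split; [apply/andP; split|]; lra.
rewrite ler_norml; have := onesided x y; have := onesided y x.
by rewrite (metric_sym y x) => h1 h2; apply/andP; split; lra.
Qed.

Lemma weight_support i x : weight i x != 0 ->
  [/\ scale (i.1 - 1) < rho x, rho x < scale (i.1 + 2) &
     exists2 s : S, p i.1 s = i.2 & mdist x (val s) < 2 * scale (i.1 + 1)].
Proof.
move=> w0; have : 0 < weight i x by rewrite lt_neqAle eq_sym w0 weight_ge0.
rewrite /weight lt_max ltxx /= !lt_min !subr_gt0 => /andP[/andP[-> ->]].
by move=> /bump_gt0[s /= ps xs]; split=> //; exists s.
Qed.

(** When the cell (k, q) has nonzero weight at x, the distance from x to the
    cell is less than 2 scale (k + 1), and the diameter of the cell is at most
    3 C scale (k + 2); both are expressed here in units of scale (k - 1), which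
    is less than rho x. *)
Definition reach : R := 2 * expR 1 ^+ 2 + 3 * C * expR 1 ^+ 3.

Lemma weight_reach i x : weight i x != 0 -> mdist x (val i.2) <= reach * rho x.
Proof.
move=> /weight_support[r1 r2 [s ps xs]].
have := (cells i.1).2 s; rewrite ps => sp.
have e1 : scale (i.1 + 1) = expR 1 ^+ 2 * scale (i.1 - 1) :> R.
  by rewrite scaleS -{1}(subrK 1 i.1) scaleS mulrA expr2.
have e2 : scale (i.1 + 2) = expR 1 ^+ 3 * scale (i.1 - 1) :> R.
  by rewrite -[2]/(1 + 1) addrA scaleS e1 mulrA -exprS.
have e0 := expR_gt0 (1 : R).
have h1 : 2 * expR 1 ^+ 2 * scale (i.1 - 1) <= 2 * expR 1 ^+ 2 * rho x.
  by rewrite ler_wpM2l ?(ltW r1)// mulr_ge0// exprn_ge0// ltW.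
have h2 : 3 * C * expR 1 ^+ 3 * scale (i.1 - 1) <= 3 * C * expR 1 ^+ 3 * rho x.
  by rewrite ler_wpM2l ?(ltW r1)// !mulr_ge0// exprn_ge0// ltW.
have := metric_triangle x (val s) (val i.2).
rewrite -[mdist (val s) _]/(mdist s i.2) /reach mulrDl => tri.
rewrite (le_trans tri)// lerD//; [apply: le_trans h1|apply: le_trans h2].
  by rewrite -mulrA -e1 ltW.
by rewrite (le_trans sp)// -(mulrA (3 * C)) -e2 mulrCA mulrA.
Qed.

(** Up to three scales are active at x, and all active cells of scale k meet the
    ball of radius 3 scale (k + 2) around a point s of S close to x, which is
    why the partition of that scale is used. *)
Lemma weight_finite x : 0 < rho x -> exists e : seq (int * S),
  [/\ uniq e, (size e <= 3 * #|T|)%N & forall i, weight i x != 0 -> i \in e].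
Proof.
move=> rx; have [K /andP[K1 K2]] := scale_bracket rx.
have [|s xs] := @set_dist_lt _ _ _ S0 x (2 * rho x); first by rewrite -/rho; lra.
have /choice[c cP] := fun k => ((cells k).1.2 s).
have /choice[q qP] : forall kt : int * T, exists u : S, forall y,
    mdist s y <= 3 * scale (kt.1 + 2) -> c kt.1 y = kt.2 -> p kt.1 y = u.
  move=> [k t] /=; have [[y [sy cy]]|nex] := pselect (exists y,
      mdist s y <= 3 * scale (k + 2) /\ c k y = t); last first.
    by exists s => y sy cy; case: nex; exists y.
  by exists (p k y) => y' sy' cy'; apply: (cP k) => //; rewrite cy cy'.
exists (undup [seq (k, q (k, t)) | k <- [:: K - 1; K; K + 1], t <- enum T]).
split; first exact: undup_uniq.
  by rewrite (leq_trans (size_undup _))// size_allpairs -cardT.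
move=> [k u] wku; rewrite mem_undup.
have [r1 r2 [y py xy]] := weight_support wku; rewrite /= in r1 r2 py xy.
have k1 : k - 1 < K + 1 by rewrite -(@lt_scale R) (lt_trans r1).
have k2 : K < k + 2 by rewrite -(@lt_scale R) (le_lt_trans K1).
have kS : scale (k + 2) = expR 1 * scale (k + 1) :> R by rewrite -scaleS -addrA.
have eS : 2 * scale (k + 1) <= scale (k + 2) :> R.
  by rewrite kS ler_wpM2r ?expR1_ge2// ltW// scale_gt0.
have sy : mdist s y <= 3 * scale (k + 2).
  have := metric_triangle (val s) x (val y).
  rewrite (metric_sym (val s) x) -[mdist (val s) (val y)]/(mdist s y); lra.
apply/allpairsPdep; exists k, (c k y); split=> /=.
- have kK : [\/ k = K - 1, k = K | k = K + 1].
    have [] : k = K - 1 \/ (k = K \/ k = K + 1) by lia.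
      by constructor 1.
    by case=> ->; [constructor 2|constructor 3].
  by rewrite !inE; case: kK => ->; rewrite eqxx ?orbT.
- by rewrite mem_enum.
- by rewrite -(qP (k, c k y) y)//= py.
Qed.

Definition total (x : M) : R := \sum_(i \in [set: int * S]) weight i x.

(** At the scale k with scale k <= rho x < scale (k + 1), the cell of a point s
    of S at distance less than scale (k + 1) from x has weight at least
    rho x / 2. *)
Lemma total_ge x : 0 < rho x -> rho x / 2 <= total x.
Proof.
move=> rx; have [e [ue _ eP]] := weight_finite rx.
have [K /andP[K1 K2]] := scale_bracket rx.
have [s xs] := set_dist_lt S0 K2.
pose i := (K, p K s).
have K3 : scale (K + 2) = expR 1 * scale (K + 1) :> R by rewrite -scaleS -addrA.
have K4 : scale K = expR 1 * scale (K - 1) :> R by rewrite -scaleS subrK.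
have e2 := @expR1_ge2 R.
have K5 : 2 * scale (K + 1) <= scale (K + 2) :> R.
  by rewrite K3 ler_wpM2r// ltW// scale_gt0.
have K6 : 2 * scale (K - 1) <= scale K :> R.
  by rewrite K4 ler_wpM2r// ltW// scale_gt0.
have := @bump_ge _ _ _ (2 * scale (K + 1)) [set t | p K t = i.2] x s.
rewrite mulr_ge0 ?(ltW (scale_gt0 _))// => /(_ isT erefl) bi.
have wi : rho x / 2 <= weight i x.
  rewrite /weight le_max !le_min; apply/orP; right.
  by apply/andP; split; [apply/andP; split|]; rewrite /=; lra.
rewrite (le_trans wi)// /total (fsbig_support ue eP) (bigD1_seq i)//=.
  by rewrite lerDl sumr_ge0// => j _; exact: weight_ge0.
by apply: eP; rewrite gt_eqF// (lt_le_trans _ wi)// divr_gt0.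
Qed.

Context {X : completeNormedModType R}.
Implicit Types f g : S -> X.

Definition lipschitz_with (L : R) f :=
  forall s t, `|f s - f t| <= L * mdist s t.

Definition smoothed f (x : M) : X :=
  (total x)^-1 *: \sum_(i \in [set: int * S]) weight i x *: f i.2.

Lemma smoothed_average f x e :
  uniq e -> (forall i, weight i x != 0 -> i \in e) ->
  smoothed f x = average e (weight^~ x) (fun i => f i.2).
Proof.
move=> ue eP; rewrite /smoothed /total (fsbig_support ue eP).
rewrite (fsbig_support ue)// => i; apply: contraNT => /(contra (eP i)).
by rewrite negbK => /eqP ->; rewrite scale0r.
Qed.

Context (ap : M -> nat -> S)
  (apP : forall x n, mdist x (val (ap x n)) < rho x + n.+1%:R^-1).

(** On the closure of S, where rho x = 0, no cells are active, and the value is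
    the limit of f along the points ap x n of S which tend to x. *)
Definition extend f (x : M) : X :=
  if rho x == 0 then limn (fun n => f (ap x n)) else smoothed f x.

Lemma approach_near x (e : R) : rho x = 0 -> 0 < e ->
  \forall n \near \oo, mdist x (val (ap x n)) < e.
Proof.
move=> x0 e0; near=> n.
rewrite (lt_le_trans (apP x n))// x0 add0r ltW//.
by near: n; exact: (near_infty_natSinv_lt (PosNum e0)).
Unshelve. all: by end_near. Qed.

Lemma approach_cvg L f x : 0 <= L -> lipschitz_with L f -> rho x = 0 ->
  cvgn (fun n => f (ap x n)).
Proof.
move=> L0 fL x0; apply/cauchy_cvgP/cauchy_exP => e e0.
have e1 : 0 < e / (2 * (L + 1)) by rewrite divr_gt0// mulr_gt0//; lra.
have near1 := approach_near x0 e1; have [n0 xn0] := filter_ex near1.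
exists (f (ap x n0)).
suff : \forall n \near \oo, ball (f (ap x n0)) e (f (ap x n)) by [].
near=> n; rewrite -ball_normE /ball_ /=.
rewrite (le_lt_trans (fL _ _))//.
have xn : mdist x (val (ap x n)) < e / (2 * (L + 1)) by near: n.
have dd : mdist (ap x n0) (ap x n) < e / (L + 1).
  have := metric_triangle (val (ap x n0)) x (val (ap x n)).
  rewrite (metric_sym _ x) -/(mdist (ap x n0) (ap x n)).
  have -> : e / (L + 1) = e / (2 * (L + 1)) + e / (2 * (L + 1)) by field; lra.
  by rewrite -[mdist (val (ap x n0)) (val (ap x n))]/(mdist (ap x n0) (ap x n)); lra.
rewrite (@le_lt_trans _ _ (L * (e / (L + 1))))// ?ler_wpM2l// ?(ltW dd)//.
rewrite mulrCA gtr_pMr// ltr_pdivrMr; lra.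
Unshelve. all: by end_near. Qed.

(** The averaged values f(q) come from representatives q at distance at most
    reach * rho x <= reach * d(x, s) from x, hence at most (reach + 1) d(x, s)
    from s. *)
Lemma extend_near L f x s : 0 <= L -> lipschitz_with L f ->
  `|extend f x - f s| <= (reach + 1) * L * mdist x (val s).
Proof.
move=> L0 fL; have reach0 : 0 <= reach.
  by rewrite /reach addr_ge0// !mulr_ge0// exprn_ge0// ltW// expR_gt0.
rewrite /extend; have [x0|x0] := eqVneq (rho x) 0.
  have fcvg := approach_cvg L0 fL x0.
  apply/ler_addgt0Pr => e e0.
  have e1 : 0 < e / (2 * (L + 1)) by rewrite divr_gt0// mulr_gt0//; lra.
  have e2 : 0 < e / 2 by lra.
  have /cvgrPdist_lt/(_ _ e2) near2 := fcvg.
  have [n [xn fn]] := filter_ex (filterI (approach_near x0 e1) near2).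
  have := ler_distD (f (ap x n)) (limn (fun n => f (ap x n))) (f s).
  have := fL (ap x n) s.
  have : L * mdist (ap x n) s <= L * mdist x (val s) + e / 2.
    have : mdist (ap x n) s <= mdist x (val s) + e / (2 * (L + 1)).
      have := metric_triangle (val (ap x n)) x (val s).
      rewrite (metric_sym _ x) -[mdist (val (ap x n)) (val s)]/(mdist (ap x n) s).
      by move: xn => /=; lra.
    move=> /(ler_wpM2l L0) /le_trans; apply; rewrite mulrDr lerD2l.
    have -> : L * (e / (2 * (L + 1))) = e / 2 * (L / (L + 1)) by field; lra.
    by rewrite ler_piMr ?(ltW e2)// ler_pdivrMr; lra.
  have : L * mdist x (val s) <= (reach + 1) * L * mdist x (val s).
    rewrite -mulrA mulrDl mul1r lerDr.
    by rewrite !mulr_ge0// mdist_ge0.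
  move: fn => /=; lra.
have rx : 0 < rho x by rewrite lt_neqAle eq_sym x0 set_dist_ge0.
have [e [ue _ eP]] := weight_finite rx; rewrite (smoothed_average f ue eP).
apply: average_near.
- by rewrite !mulr_ge0 ?mdist_ge0// addr_ge0.
- by move=> i; exact: weight_ge0.
- by rewrite -(fsbig_support ue eP) (lt_le_trans _ (total_ge rx))// divr_gt0.
move=> i /weight_reach xi.
rewrite (le_trans (fL _ _))// [(_ + 1) * L]mulrC -mulrA ler_wpM2l//.
have := metric_triangle (val i.2) x (val s).
rewrite (metric_sym _ x) -[mdist (val i.2) (val s)]/(mdist i.2 s).
have : reach * rho x <= reach * mdist x (val s) by rewrite ler_wpM2l ?set_dist_le.
by rewrite [(reach + 1) * _]mulrDl mul1r; lra.
Qed.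

(** The first summand serves close points and is 2 (6 #|T|) (2 reach + 3) divided
    by the lower bound 1 / 2 of the ratio of total to rho; the second serves
    distant points, whose distances to a suitable s are at most 3 d and 4 d. *)
Definition extend_const : R := 24 * #|T|%:R * (2 * reach + 3) + 7 * (reach + 1).

(** Let d = d(x, y).  When rho x <= 2 d, compare both values with f(s) for a
    point s of S at distance at most 3 d from x.  Otherwise rho x and rho y
    differ by at most a factor 2, and the weights at x and y, of which at most
    6 #|T| are nonzero, are compared on their joint support. *)
Lemma extend_lipschitz L f x y : 0 <= L -> lipschitz_with L f ->
  `|extend f x - extend f y| <= extend_const * L * mdist x y.
Proof.
move=> L0 fL; have reach0 : 0 <= reach.
  by rewrite /reach addr_ge0// !mulr_ge0// exprn_ge0// ltW// expR_gt0.
have [->|xy] := eqVneq x y; first by rewrite subrr normr0 mdistxx mulr0.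
have d0 : 0 < mdist x y by rewrite mdist_gt0.
set d := mdist x y in d0 *.
have Ld : 0 <= L * d by rewrite mulr_ge0// ltW.
have c1 : 0 <= 24 * #|T|%:R * (2 * reach + 3).
  by rewrite !mulr_ge0// addr_ge0// mulr_ge0.
rewrite /extend_const mulrDl mulrDl.
have [far|near] := leP (rho x) (2 * d).
  have [|s xs] := @set_dist_lt _ _ _ S0 x (rho x + d); first by rewrite /rho ltrDl.
  have ys : mdist y (val s) <= 4 * d.
    by have := metric_triangle y x (val s); rewrite (metric_sym y x) -/d; lra.
  have := extend_near x s L0 fL; have := extend_near y s L0 fL.
  have := ler_distD (f s) (extend f x) (extend f y).
  rewrite [`|f s - _|]distrC.
  have K0 : 0 <= (reach + 1) * L by rewrite mulr_ge0// addr_ge0.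
  have : (reach + 1) * L * mdist y (val s) <= (reach + 1) * L * (4 * d).
    by rewrite ler_wpM2l.
  have : (reach + 1) * L * mdist x (val s) <= (reach + 1) * L * (3 * d).
    by rewrite ler_wpM2l//; lra.
  have := mulr_ge0 c1 Ld; rewrite mulrA.
  have -> : 7 * (reach + 1) * L * d =
      (reach + 1) * L * (4 * d) + (reach + 1) * L * (3 * d) by ring.
  lra.
have rx : 0 < rho x by lra.
have rxy := set_dist_lip S0 x y; have ryx := set_dist_lip S0 y x.
rewrite -/rho (metric_sym y x) -/d in rxy ryx.
have ry : 0 < rho y by lra.
rewrite /extend !gt_eqF//.
have [e1 [ue1 se1 eP1]] := weight_finite rx.
have [e2 [ue2 se2 eP2]] := weight_finite ry.
pose e := undup (e1 ++ e2).
have ue : uniq e by exact: undup_uniq.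
have ePx i : weight i x != 0 -> i \in e.
  by rewrite mem_undup mem_cat => /eP1 ->.
have ePy i : weight i y != 0 -> i \in e.
  by rewrite mem_undup mem_cat => /eP2 ->; rewrite orbT.
have se : (size e)%:R <= 6 * #|T|%:R :> R.
  rewrite -natrM ler_nat (leq_trans (size_undup _))// size_cat.
  by rewrite (leq_trans (leq_add se1 se2))// -mulnDl.
rewrite (smoothed_average f ue ePx) (smoothed_average f ue ePy).
have [|s xs] := @set_dist_lt _ _ _ S0 x (2 * rho x); first by rewrite -/rho; lra.
have tx := total_ge rx; have ty := total_ge ry.
have l0 : 0 <= L * ((2 * reach + 3) * rho x).
  by rewrite !mulr_ge0 ?(ltW rx)// addr_ge0// mulr_ge0.
have := @average_diff _ X _ e (weight^~ x) (weight^~ y) (fun i => f i.2) (f s) d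
  (L * ((2 * reach + 3) * rho x)) l0 (ltW d0) (weight_ge0^~ x) (weight_ge0^~ y).
rewrite -(fsbig_support ue ePx) -(fsbig_support ue ePy) -/(total x) -/(total y).
have tx0 : 0 < total x by lra.
have ty0 : 0 < total y by lra.
move=> /(_ tx0 ty0 (fun i => weight_lip i x y)) h.
apply: (le_trans (h _)) => [i wi|].
  rewrite (le_trans (fL _ _))// ler_wpM2l//.
  have rr : reach * rho y <= reach * (2 * rho x) by rewrite ler_wpM2l//; lra.
  have rr0 : 0 <= reach * rho x by rewrite mulr_ge0// ltW.
  have tri := metric_triangle (val i.2) x (val s).
  rewrite (metric_sym _ x) -[mdist (val i.2) (val s)]/(mdist i.2 s) in tri.
  case: wi => /weight_reach iw; first by lra.
  by have := metric_triangle x y (val i.2); rewrite -/d; lra.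
rewrite ler_pdivrMr//.
have -> : 2 * (size e)%:R * d * (L * ((2 * reach + 3) * rho x)) =
   (size e)%:R * (2 * (2 * reach + 3) * (L * d) * rho x) by ring.
have r3 : 0 <= 2 * reach + 3 by lra.
have w0 : 0 <= 2 * (2 * reach + 3) * (L * d) * rho x by rewrite !mulr_ge0// ltW.
rewrite (le_trans (ler_wpM2r w0 se))//.
have -> : 6 * #|T|%:R * (2 * (2 * reach + 3) * (L * d) * rho x) =
  (24 * #|T|%:R * (2 * reach + 3) * L * d) * (rho x / 2) by field.
have k0 : 0 <= 24 * #|T|%:R * (2 * reach + 3) * L * d.
  by rewrite -mulrA mulr_ge0.
have k1 : 0 <= 7 * (reach + 1) * L * d.
  by rewrite -mulrA mulr_ge0// mulr_ge0// addr_ge0.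
by rewrite ler_pM ?(ltW tx0)// ?lerDl// divr_ge0// ltW.
Qed.

Lemma extend_linear L L' (a : R) f g x : 0 <= L -> 0 <= L' ->
  lipschitz_with L f -> lipschitz_with L' g ->
  extend (fun s => a *: f s + g s) x = a *: extend f x + extend g x.
Proof.
move=> L0 L0' fL gL; rewrite /extend; have [x0|x0] := eqVneq (rho x) 0.
  have fc := approach_cvg L0 fL x0; have gc := approach_cvg L0' gL x0.
  apply: cvg_lim => //; apply: cvgD => //; exact: cvgZr.
have rx : 0 < rho x by rewrite lt_neqAle eq_sym x0 set_dist_ge0.
have [e [ue _ eP]] := weight_finite rx.
rewrite !(smoothed_average _ ue eP) /average scalerA mulrC -scalerA -scalerDr.
congr (_ *: _); rewrite scaler_sumr -big_split /=; apply: eq_bigr => i _.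
by rewrite scalerDr !scalerA mulrC.
Qed.

End extension_operator.

(** * The extension constant *)

Section lipschitz_norm.
Context {R : realType} {M : metricType R} {X : normedModType R}.

Lemma le_lip_norm (f : Lip M X) x y : `|f x - f y| <= lip_norm f * mdist x y.
Proof.
have [->|xy] := eqVneq x y; first by rewrite subrr normr0 mdistxx mulr0.
have d0 : 0 < mdist x y by rewrite mdist_gt0.
rewrite -ler_pdivrMr//; apply: ub_le_sup; last by exists (x, y) => //=; exact/eqP.
have := valP f; rewrite inE => -[k fk]; exists k => _ [[u v] /= /eqP uv <-].
rewrite ler_pdivrMr ?mdist_gt0//; exact: fk.
Qed.

Lemma lip_norm_ge0 (f : Lip M X) : 0 <= lip_norm f.
Proof.
have [[[x y] xy]|nex] := pselect (exists p : M * M, p.1 <> p.2).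
  have d0 : 0 < mdist x y by rewrite mdist_gt0; exact/eqP.
  by rewrite -(pmulr_lge0 _ d0) (le_trans (normr_ge0 _) (le_lip_norm f x y)).
rewrite /lip_norm (_ : [set p : M * M | p.1 <> p.2] = set0) ?image_set0 ?sup0//.
by apply/seteqP; split=> // p pp; case: nex; exists p.
Qed.

Lemma lip_norm_le (f : Lip M X) (k : R) : 0 <= k ->
  (forall x y, `|f x - f y| <= k * mdist x y) -> lip_norm f <= k.
Proof.
move=> k0 fk; have [[p pp]|nex] := pselect (exists p : M * M, p.1 <> p.2).
  apply: ge_sup; first by exists (`|f p.1 - f p.2| / mdist p.1 p.2), p.
  move=> _ [[u v] /= /eqP uv <-].
  by rewrite ler_pdivrMr ?mdist_gt0.
rewrite /lip_norm (_ : [set p : M * M | p.1 <> p.2] = set0) ?image_set0 ?sup0//.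
by apply/seteqP; split=> // p pp; case: nex; exists p.
Qed.

End lipschitz_norm.

Section extension_constant.
Context {R : realType} {M : metricType R} (S : set M).

(** Lipschitz bounds give at once the continuity of the operator for the
    seminorms and the bound on its operator norm. *)
Lemma ext_constant_le (X : normedModType R) (E : (S -> X) -> M -> X) (K : R) :
  0 <= K ->
  (forall (a : R) (f g : Lip S X) x,
    E (fun s => a *: f s + g s) x = a *: E f x + E g x) ->
  (forall (f : Lip S X) x y, `|E f x - E f y| <= K * lip_norm f * mdist x y) ->
  (forall (f : Lip S X) s, E f (val s) = f s) ->
  (ext_constant S X <= K%:E)%E.
Proof.
move=> K0 Elin Elip Erestr.
have Epred (f : Lip S X) : E f \in lipschitz_pred (X := X).
  by rewrite inE; exists (K * lip_norm f).
pose T0 f := MkLip (Epred f).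
have T0lin : linear T0.
  by move=> a f g; apply/val_inj/funext => x; rewrite linearP /=; exact: Elin.
pose T1 : {linear Lip S X -> Lip M X} :=
  HB.pack T0 (GRing.isLinear.Build R (Lip S X) (Lip M X) *:%R T0 T0lin).
have Tnorm f : lip_norm (T1 f) <= K * lip_norm f.
  by apply: lip_norm_le => [|x y]; [rewrite mulr_ge0// lip_norm_ge0|exact: Elip].
apply: (@le_trans _ _ (lip_opnorm T1)).
  apply: ereal_inf_lbound; exists T1 => //; split=> [f e e0|f s]; last exact: Erestr.
  exists (e / (K + 1)); first by rewrite divr_gt0//; lra.
  move=> g gf; rewrite -raddfB (le_lt_trans (Tnorm _))//.
  rewrite (@le_lt_trans _ _ (K * (e / (K + 1))))// ?ler_wpM2l// ?(ltW gf)//.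
  by rewrite mulrCA gtr_pMr// ltr_pdivrMr; lra.
apply: ge_ereal_sup => _ [f /= f1 <-]; rewrite lee_fin.
by rewrite (le_trans (Tnorm f))// ler_piMr.
Qed.

(** The bound depends on the partitions of S only, so it serves all the metric
    spaces M that contain a copy of S. *)
Theorem partition_ext_constant (C : R) (T : finType) : 0 <= C ->
  (forall r, 0 < r -> exists p : S -> S, cell_map T C r p) ->
  forall X : completeNormedModType R, (ext_constant S X <= (extend_const C T)%:E)%E.
Proof.
move=> C0 cells X.
have K0 : 0 <= extend_const C T.
  have r0 : 0 <= reach C.
    by rewrite /reach addr_ge0// !mulr_ge0// exprn_ge0// ltW// expR_gt0.
  by rewrite /extend_const addr_ge0// !mulr_ge0// addr_ge0// mulr_ge0.
have [S0|S0] := pselect (inhabited S); last first.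
  apply: (@ext_constant_le X (fun _ _ => 0)) => //.
  - by move=> *; rewrite scaler0 addr0.
  - by move=> f x y; rewrite subrr normr0 !mulr_ge0// ?lip_norm_ge0 ?mdist_ge0.
  - by move=> f s; case: S0.
have /choice[p pP] : forall k : int, exists p : S -> S,
    cell_map T C (3 * scale (k + 2)) p /\
    forall s, mdist s (p s) <= C * (3 * scale (k + 2)).
  move=> k; have [|p /cell_map_rep//] := cells (3 * scale (k + 2)).
  by rewrite mulr_gt0// scale_gt0.
have /choice[ap apP] : forall xn : M * nat, exists s : S,
    mdist xn.1 (val s) < set_dist S xn.1 + xn.2.+1%:R^-1.
  by move=> [x n]; apply: set_dist_lt => //=; rewrite ltrDl invr_gt0.
have apP' x n := apP (x, n).
have fL (f : Lip S X) : lipschitz_with (lip_norm f) f by exact: le_lip_norm.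
apply: (@ext_constant_le X (extend p (fun x n => ap (x, n)))) => //.
- move=> a f g x; exact: (extend_linear S0 C0 pP apP' a x (lip_norm_ge0 f)
    (lip_norm_ge0 g) (fL f) (fL g)).
- move=> f x y; exact: (extend_lipschitz S0 C0 pP apP' x y (lip_norm_ge0 f) (fL f)).
- move=> f s; apply/eqP; rewrite -subr_eq0 -normr_le0.
  have := extend_near S0 C0 pP apP' (val s) s (lip_norm_ge0 f) (fL f).
  by rewrite mdistxx mulr0.
Qed.

End extension_constant.

Lemma partitionable_universal (R : realType) (U : metricType R) :
  partitionable U -> universal U.
Proof.
move=> [C [T [C0 cells]]]; exists (extend_const C T) => M S [V [phi [_ iso]]] X.
apply: partition_ext_constant => // r r0; have [p pP] := cells r r0.
have isoS : Defs.isometry (fun s => val (phi s)) by move=> x y; rewrite -iso.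
by have [q [qP _]] := cell_map_rep (cell_map_isometry isoS pP); exists q.
Qed.

Theorem corollary1p9 (R : realType) (N : nat) (N_ge1 : (1 <= N)%N)
    (M : 'I_N -> metricType R)
    (hM : forall i, doubling (M i) \/
                    (gromov_hyperbolic (M i) /\ bounded_geometry (M i))) :
  universal (direct_sum M).
Proof.
apply/partitionable_universal/partitionable_direct_sum => i.
case: (hM i) => [|[]]; first exact: doubling_partitionable.
exact: hyperbolic_partitionable.
Qed.
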